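(* Suppose $d\ge2$, $\gamma\ge100/101$ and $T\ge45(d-1)^2/(1-\gamma)$. Then for any policy $\pi$ there exists an MDP $M_\theta$ of the family below (with $\delta=1-\gamma$) such that $L_\theta\le100/99$, $L_\varphi\le1+\log(\gamma/(1-\gamma))$, and $\mathbb E[\mathrm{Regret}(M_\theta,\pi,x_0,T)]\ge\frac{\gamma}{3375(1-\gamma)^{3/2}}d\sqrt T-\frac{\gamma}{(1-\gamma)^2}$, where the expectation is over the randomness of $M_\theta$ and $\pi$.
   Context: Family $M_\theta$: two states $x_0,x_1$; actions $\mathcal A=\{-1,1\}^{d-1}$; rewards $r(x_0,a)=0$, $r(x_1,a)=1$. Parameters: $\delta=1-\gamma$, $\Delta=(d-1)/(45\sqrt{(2/5)(T/\delta)\log2})$, $\bar\Delta=\log\frac{(1-\delta)(\delta+\Delta)}{\delta(1-\delta-\Delta)}$, $\alpha=\sqrt{\bar\Delta/((d-1)(1+\bar\Delta))}$, $\beta=\sqrt{1/(1+\bar\Delta)}$. Features: $\varphi(x_0,a,x_0)=(-\alpha a,\beta\log(\delta^{-1}-1))$, $\varphi(x_0,a,x_1)=\varphi(x_1,a,x_0)=(0,0)$, $\varphi(x_1,a,x_1)=(0,\beta\log(\delta^{-1}-1))$. For $\theta\in\{-\bar\Delta/(d-1),\bar\Delta/(d-1)\}^{d-1}$, $\bar\theta=(\theta/\alpha,1/\beta)$ and $p(x_j\mid x_i,a)=\exp(\varphi(x_i,a,x_j)^\top\bar\theta)/\sum_{j'\in\{0,1\}}\exp(\varphi(x_i,a,x_{j'})^\top\bar\theta)$,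 so $p(x_1\mid x_0,a)=1/(1+(\delta^{-1}-1)e^{-a^\top\theta})$, $p(x_0\mid x_1,a)=\delta$. $L_\theta=\|\bar\theta\|_2$, $L_\varphi=\max\|\varphi\|_2$. Discounted criterion with factor $\gamma$: for a (history-dependent) policy $\pi$, $V^\pi_t(s)=\mathbb E[\sum_{i\ge0}\gamma^ir(s_{t+i},a_{t+i})\mid s_t=s]$, $V^*$ the optimal value function, and with $s_1=x_0$, $\mathrm{Regret}(M_\theta,\pi,x_0,T)=\sum_{t=1}^TV^*(s_t)-\sum_{t=1}^TV^\pi_t(s_t)$. *)

(* Defs.v *)
From mathcomp Require Import all_boot all_order all_algebra.
From mathcomp Require Import all_classical all_reals.
From mathcomp Require Import topology normedtype sequences exp.
Set Implicit Arguments. Unset Strict Implicit. Unset Printing Implicit Defensive.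
Import Order.TTheory GRing.Theory Num.Theory numFieldNormedType.Exports.
Local Open Scope ring_scope.

Section LBMDP.
Variables (R : realType) (d : nat) (T : nat) (gamma : R).

(* states: false = x_0, true = x_1 *)
Definition St := bool.
(* actions in {-1,1}^(d-1): a boolean vector, true <-> +1 *)
Definition Act := {ffun 'I_(d.-1) -> bool}.
Definition sgn (b : bool) : R := if b then 1 else -1.
Definition avec (a : Act) (i : 'I_(d.-1)) : R := sgn (a i).

Definition reward (s : St) : R := if s then 1 else 0.

Definition delta : R := 1 - gamma.
Definition Delta : R :=
  (d.-1)%:R / (45 * Num.sqrt ((2 / 5) * (T%:R / delta) * ln 2)).
Definition Deltabar : R :=
  ln ((1 - delta) * (delta + Delta) / (delta * (1 - delta - Delta))).
Definition alpha : R := Num.sqrt (Deltabar / ((d.-1)%:R * (1 + Deltabar))).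
Definition beta : R := Num.sqrt (1 / (1 + Deltabar)).

(* a vector of R^d = R^(d-1) x R is represented as a pair (v, c) *)
Definition vecd := (('I_(d.-1) -> R) * R)%type.
Definition dotd (u w : vecd) : R := \sum_(i < d.-1) u.1 i * w.1 i + u.2 * w.2.
Definition norm2 (u : vecd) : R := Num.sqrt (\sum_(i < d.-1) u.1 i ^+ 2 + u.2 ^+ 2).

Definition phi (s : St) (a : Act) (s' : St) : vecd :=
  match s, s' with
  | false, false => (fun i => - alpha * avec a i, beta * ln (delta^-1 - 1))
  | true, true => (fun _ => 0, beta * ln (delta^-1 - 1))
  | _, _ => (fun _ => 0, 0)
  end.

Definition theta (sig : Act) (i : 'I_(d.-1)) : R := sgn (sig i) * (Deltabar / (d.-1)%:R).
Definition thetabar (sig : Act) : vecd := (fun i => theta sig i / alpha, 1 / beta).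

Definition trans (sig : Act) (s : St) (a : Act) (s' : St) : R :=
  expR (dotd (phi s a s') (thetabar sig)) /
  \sum_(s'' : St) expR (dotd (phi s a s'') (thetabar sig)).

Definition L_theta (sig : Act) : R := norm2 (thetabar sig).
Definition L_phi : R :=
  \big[Num.max/0]_(s : St) \big[Num.max/0]_(a : Act) \big[Num.max/0]_(s' : St)
     norm2 (phi s a s').

(* history-dependent randomized policies: pi h s a = probability of action a
   given the past state-action pairs h and the current state s *)
Definition policy := seq (St * Act) -> St -> Act -> R.
Definition is_policy (pi : policy) : Prop :=
  (forall h s a, 0 <= pi h s a) /\ (forall h s, \sum_(a : Act) pi h s a = 1).

(* a continuation is a sequence of (action taken, next state) *)
Fixpoint pathP (sig : Act) (pi : policy) (h : seq (St * Act)) (s : St)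
    (c : seq (Act * St)) : R :=
  match c with
  | [::] => 1
  | (a, s') :: c' => pi h s a * trans sig s a s' * pathP sig pi (rcons h (s, a)) s' c'
  end.

Fixpoint hist_of (s : St) (c : seq (Act * St)) : seq (St * Act) :=
  match c with
  | [::] => [::]
  | (a, s') :: c' => (s, a) :: hist_of s' c'
  end.

Definition last_st (s : St) (c : seq (Act * St)) : St := last s (map snd c).

Definition cond_reward (sig : Act) (pi : policy) (h : seq (St * Act)) (s : St) (i : nat) : R :=
  \sum_(c : i.-tuple (Act * St)) pathP sig pi h s c * reward (last_st s c).

Definition Vpi (sig : Act) (pi : policy) (h : seq (St * Act)) (s : St) : R :=
  limn (series (fun i : nat => gamma ^+ i * cond_reward sig pi h s i : R)).

Definition Vstar (sig : Act) (s : St) : R :=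
  sup [set v | exists pi : policy, is_policy pi /\ v = Vpi sig pi [::] s].

Definition ExpRegret (sig : Act) (pi : policy) : R :=
  \sum_(t < T) \sum_(c : t.-tuple (Act * St))
     pathP sig pi [::] false c *
     (Vstar sig (last_st false c) - Vpi sig pi (hist_of false c) (last_st false c)).

End LBMDP.

(* Main.v *)
Require Import Defs.
From mathcomp Require Import all_boot all_order all_algebra.
From mathcomp Require Import all_classical all_reals.
From mathcomp Require Import topology normedtype sequences exp.
From mathcomp Require Import ring lra.
Import Order.TTheory GRing.Theory Num.Theory numFieldNormedType.Exports.
Local Open Scope classical_set_scope.
Local Open Scope ring_scope.

(** The Bellman equations turn the discounted regret into
    [(1 / (1 - gamma)) * sum_u E[gap at time u]] up to [gamma / (1 - gamma)^2];
    the gap of an action in [x_0] is at least proportional to the number of its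
    signs that differ from those of [theta].  Flipping one sign of [theta]
    gives transitions at chi-square divergence O(1/T), so a policy cannot tell
    the two MDPs apart within T steps: on average over [theta] a
    constant proportion of the signs played in [x_0], where the chain spends about
    half of its time, is wrong.  The change of measure is the iterated
    Cauchy-Schwarz inequality [(E' f)^2 <= C^T E f^2] applied to [f = 1 + lam * g]. *)

(** * Finite-horizon expectations *)

Section Step.
Context {R : realType} {S A : finType}.
Implicit Types (P : S -> A -> S -> R) (pi : seq (S * A) -> S -> A -> R).
Implicit Types (F G : seq (S * A) -> S -> R).

Definition stochastic P := (forall s a s', 0 <= P s a s') /\
  (forall s a, \sum_s' P s a s' = 1).

Definition randomized pi := (forall h s a, 0 <= pi h s a) /\
  (forall h s, \sum_a pi h s a = 1).

(** One-step conditional expectation. It acts on functions of the history as well as of the state,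
    because the policy may depend on the past; its [n]-th iterate is the expectation [n] steps
    ahead. *)
Definition step P pi F : seq (S * A) -> S -> R :=
  fun h s => \sum_a pi h s a * \sum_s' P s a s' * F (rcons h (s, a)) s'.

Lemma eq_iter_step P pi n F G : (forall h s, F h s = G h s) ->
  forall h s, iter n (step P pi) F h s = iter n (step P pi) G h s.
Proof.
move=> FG; elim: n => [|n IH] h s //=.
apply: eq_bigr => a _; congr (_ * _); apply: eq_bigr => s' _.
by rewrite IH.
Qed.

Lemma iter_stepD P pi n x y F G h s :
  iter n (step P pi) (fun h s => x * F h s + y * G h s) h s =
  x * iter n (step P pi) F h s + y * iter n (step P pi) G h s.
Proof.
elim: n h s => [|n IH] h s //=; rewrite !mulr_sumr -big_split /=.
apply: eq_bigr => a _; rewrite (mulrCA x) (mulrCA y) -mulrDr.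
congr (_ * _); rewrite !mulr_sumr -big_split /=; apply: eq_bigr => s' _.
by rewrite IH; ring.
Qed.

Lemma iter_step0 P pi n h s : iter n (step P pi) (fun _ _ => 0) h s = 0.
Proof.
elim: n h s => [|n IH] h s //=; apply: big1 => a _.
by rewrite big1 ?mulr0 // => s' _; rewrite IH mulr0.
Qed.

Lemma iter_step_sum P pi n (I : Type) (r : seq I) (F : I -> seq (S * A) -> S -> R) h s :
  iter n (step P pi) (fun h s => \sum_(i <- r) F i h s) h s =
  \sum_(i <- r) iter n (step P pi) (F i) h s.
Proof.
elim: r => [|i r IH].
  rewrite big_nil -[RHS](iter_step0 P pi n h s); apply: eq_iter_step => h' s'.
  by rewrite big_nil.
rewrite big_cons -IH.
rewrite -[X in X + _]mul1r -[X in _ + X]mul1r -iter_stepD.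
by apply: eq_iter_step => h' s'; rewrite big_cons !mul1r.
Qed.

Section Markov.
Variables (P : S -> A -> S -> R) (pi : seq (S * A) -> S -> A -> R).
Hypotheses (stP : stochastic P) (rpi : randomized pi).

Lemma ler_iter_step n F G : (forall h s, F h s <= G h s) ->
  forall h s, iter n (step P pi) F h s <= iter n (step P pi) G h s.
Proof.
move=> FG; elim: n => [|n IH] h s //=.
apply: ler_sum => a _; apply: ler_wpM2l; first exact: rpi.1.
apply: ler_sum => s' _; apply: ler_wpM2l; [exact: stP.1 | exact: IH].
Qed.

Lemma iter_step_cst n c h s : iter n (step P pi) (fun _ _ => c) h s = c.
Proof.
elim: n h s => [|n IH] h s //=.
rewrite /step; under eq_bigr => a _.
  under eq_bigr => s' _ do rewrite IH.
  rewrite -mulr_suml stP.2 mul1r; over.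
by rewrite -mulr_suml rpi.2 mul1r.
Qed.

Lemma iter_step_ge0 n F : (forall h s, 0 <= F h s) ->
  forall h s, 0 <= iter n (step P pi) F h s.
Proof.
by move=> F0 h s; rewrite -(iter_step_cst n 0 h s); exact: ler_iter_step.
Qed.

Lemma iter_step_le n F c : (forall h s, F h s <= c) ->
  forall h s, iter n (step P pi) F h s <= c.
Proof.
by move=> Fc h s; rewrite -(iter_step_cst n c h s); exact: ler_iter_step.
Qed.

End Markov.

(* Expanding [0 <= \sum w (f - m r / C) ^ 2] with [m = \sum w r f]. *)
Lemma weighted_Cauchy (I : finType) (w r f : I -> R) (C : R) :
  0 < C -> (forall i, 0 <= w i) -> \sum_i w i * r i ^+ 2 <= C ->
  (\sum_i w i * r i * f i) ^+ 2 <= C * \sum_i w i * f i ^+ 2.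
Proof.
move=> C0 w0 rC; set m := \sum_i w i * r i * f i.
have : 0 <= \sum_i w i * (f i - m / C * r i) ^+ 2.
  by apply: sumr_ge0 => i _; rewrite mulr_ge0 ?sqr_ge0.
have -> : \sum_i w i * (f i - m / C * r i) ^+ 2 =
   \sum_i w i * f i ^+ 2 - 2 * (m / C) * m + (m / C) ^+ 2 * \sum_i w i * r i ^+ 2.
  rewrite /m !mulr_sumr -sumrB -big_split /=; apply: eq_bigr => i _; ring.
set X := \sum_i w i * f i ^+ 2; set Y := \sum_i w i * r i ^+ 2 in rC *.
move=> H.
have H2 : (m / C) ^+ 2 * Y <= (m / C) ^+ 2 * C by rewrite ler_wpM2l ?sqr_ge0.
have H3 : (m / C) ^+ 2 * C = m ^+ 2 / C by field; rewrite gt_eqF.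
have H4 : 2 * (m / C) * m = 2 * (m ^+ 2 / C) by field; rewrite gt_eqF.
rewrite mulrC -ler_pdivrMr //; lra.
Qed.

(** Each step is Cauchy-Schwarz on pairs (action, next state), with weights [pi * P] and ratio
    [P' / P]. The policy is common to both laws and cancels in the ratio, so every step costs the
    same factor [C], whatever the policy. *)
Lemma iter_step_sqr P P' pi (C : R) n F h s :
  stochastic P -> randomized pi -> 0 < C ->
  (forall s a s', 0 < P s a s') ->
  (forall s a, \sum_s' P' s a s' ^+ 2 / P s a s' <= C) ->
  iter n (step P' pi) F h s ^+ 2 <=
    C ^+ n * iter n (step P pi) (fun h s => F h s ^+ 2) h s.
Proof.
move=> stP rpi C0 P0 PC; elim: n h s => [|n IH] h s /=; first by rewrite mul1r.
set G := iter n (step P' pi) F in IH *.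
apply: (@le_trans _ _ (C * step P pi (fun h s => G h s ^+ 2) h s)).
  have := @weighted_Cauchy (A * S)%type (fun u => pi h s u.1 * P s u.1 u.2)
    (fun u => P' s u.1 u.2 / P s u.1 u.2) (fun u => G (rcons h (s, u.1)) u.2) C C0.
  move=> /(_ _ _)/wrap[||].
  - by move=> u; rewrite mulr_ge0 ?rpi.1 // ltW.
  - rewrite -(pair_bigA _ (fun a s' => pi h s a * P s a s' * (P' s a s' / P s a s') ^+ 2)) /=.
    rewrite -[leRHS]mul1r -(rpi.2 h s) mulr_suml; apply: ler_sum => a _.
    apply: le_trans (ler_wpM2l (rpi.1 h s a) (PC s a)); rewrite mulr_sumr.
    apply: ler_sum => s' _; rewrite le_eqVlt; apply/orP; left; apply/eqP.
    by field; rewrite gt_eqF.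
  rewrite -(pair_bigA _ (fun a s' => pi h s a * P s a s' * (P' s a s' / P s a s') *
    G (rcons h (s, a)) s')) /=.
  rewrite -(pair_bigA _ (fun a s' => pi h s a * P s a s' * G (rcons h (s, a)) s' ^+ 2)) /=.
  move=> H; rewrite /step; apply: le_trans (le_trans H _).
    rewrite le_eqVlt; apply/orP; left; apply/eqP; congr (_ ^+ 2).
    apply: eq_bigr => a _; rewrite mulr_sumr; apply: eq_bigr => s' _.
    by field; rewrite gt_eqF.
  rewrite le_eqVlt; apply/orP; left; apply/eqP; congr (_ * _).
  by apply: eq_bigr => a _; rewrite mulr_sumr; apply: eq_bigr => s' _; rewrite mulrA.
rewrite exprS -mulrA ler_pM2l // /step mulr_sumr; apply: ler_sum => a _.
rewrite [leRHS]mulrCA; apply: ler_wpM2l; first exact: rpi.1.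
rewrite mulr_sumr; apply: ler_sum => s' _.
rewrite [leRHS]mulrCA; apply: ler_wpM2l; [exact: stP.1 | exact: IH].
Qed.

(* [iter_step_sqr] for [1 + lam * g]: after division by [2 * lam] the error is of order
   [(C ^+ n - 1) / lam + lam]. *)
Lemma change_of_measure P P' pi (C lam : R) n g h s :
  stochastic P -> stochastic P' -> randomized pi -> 0 < C -> 0 < lam ->
  (forall s a s', 0 < P s a s') ->
  (forall s a, \sum_s' P' s a s' ^+ 2 / P s a s' <= C) ->
  (forall h s, 0 <= g h s <= 1) ->
  2 * lam * iter n (step P' pi) g h s <=
   C ^+ n * (1 + 2 * lam * iter n (step P pi) g h s + lam ^+ 2) - 1.
Proof.
move=> stP stP' rpi C0 lam0 P0 PC g01.
have := iter_step_sqr P P' pi C n (fun h s => 1 * 1 + lam * g h s) h s stP rpi C0 P0 PC.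
rewrite iter_stepD iter_step_cst //.
set E' := iter n (step P' pi) g h s; set E := iter n (step P pi) g h s.
have : iter n (step P pi) (fun h s => (1 * 1 + lam * g h s) ^+ 2) h s <=
   iter n (step P pi) (fun h s => (1 + lam ^+ 2) * 1 + (2 * lam) * g h s) h s.
  apply: ler_iter_step => // h' s'; have /andP[g0 g1] := g01 h' s'.
  have : lam ^+ 2 * (g h' s' ^+ 2) <= lam ^+ 2 * 1.
    by rewrite ler_wpM2l ?sqr_ge0 // expr_le1.
  lra.
rewrite iter_stepD iter_step_cst // -/E => H1 H2.
have Cn : 0 <= C ^+ n by rewrite exprn_ge0 // ltW.
have H3 := ler_wpM2l Cn H1.
have := sqr_ge0 (lam * E'); lra.
Qed.

(** Telescoping of [gamma ^+ i] times the expectation of [U] at time [i]. *)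
Lemma iter_step_Bellman P pi (U : S -> R) (gamma : R) (n : nat) h s :
  U s = \sum_(i < n) gamma ^+ i *
     iter i (step P pi) (fun h s => U s - gamma * step P pi (fun _ => U) h s) h s
   + gamma ^+ n * iter n (step P pi) (fun _ => U) h s.
Proof.
elim: n => [|n IH]; first by rewrite big_ord0 add0r mul1r.
rewrite {1}IH big_ord_recr /= -addrA; congr (_ + _).
under [in RHS]eq_iter_step => h' s' do rewrite -[U s']mul1r -mulNr.
rewrite iter_stepD -iterSr exprS; rewrite /=; ring.
Qed.

End Step.

(** * Performance difference *)

Lemma sum_tupleS {R : nmodType} {X : finType} n (F : seq X -> R) :
  \sum_(c : n.+1.-tuple X) F c = \sum_(x : X) \sum_(c : n.-tuple X) F (x :: c).
Proof.
rewrite pair_bigA /=.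
rewrite (reindex (fun p : X * n.-tuple X => [tuple of p.1 :: p.2])) //=.
exists (fun t => (thead t, [tuple of behead t])) => [[x c] _|c _] /=.
  by rewrite theadE; congr pair; apply: val_inj.
by rewrite [RHS]tuple_eta.
Qed.

Section PerformanceDifference.
Context {R : realType} {d : nat}.
Variables (T : nat) (gamma : R) (sig : Act d).
Let P : St -> Act d -> St -> R := trans T gamma sig.

(** Passage from sums over trajectories to iterates of [step]. The initial history [h] is arbitrary
    so that the induction can prepend a step. *)
Lemma sum_pathP (pi : policy R d) n F h s :
  \sum_(c : n.-tuple (Act d * St)) Defs.pathP T gamma sig pi h s c *
     F (h ++ hist_of s c) (last_st s c) = iter n (step P pi) F h s.
Proof.
elim: n h s => [|n IH] h s /=.
  rewrite (big_pred1 [tuple]) /=; first by rewrite cats0 mul1r.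
  by move=> c /=; apply/esym/eqP/val_inj; case: c => [[]].
rewrite (sum_tupleS n (fun c => Defs.pathP T gamma sig pi h s c *
     F (h ++ hist_of s c) (last_st s c))).
transitivity (\sum_(p : Act d * St) pi h s p.1 * (P s p.1 p.2 *
    iter n (step P pi) F (rcons h (s, p.1)) p.2)); last first.
  rewrite -(pair_bigA _ (fun a s' => pi h s a * (P s a s' *
    iter n (step P pi) F (rcons h (s, a)) s'))) /=.
  by apply: eq_bigr => a _; rewrite mulr_sumr.
apply: eq_bigr => [[a s']] _; rewrite -IH !mulr_sumr; apply: eq_bigr => c _.
by rewrite cat_rcons /= -!mulrA.
Qed.

Lemma cond_rewardE (pi : policy R d) h s i :
  cond_reward T gamma sig pi h s i = iter i (step P pi) (fun _ s => reward R s) h s.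
Proof. by rewrite -sum_pathP. Qed.

Lemma ExpRegretE (pi : policy R d) :
  ExpRegret T gamma sig pi = \sum_(t < T) iter t (step P pi)
    (fun h s => Vstar T gamma sig s - Vpi T gamma sig pi h s) [::] false.
Proof. by apply: eq_bigr => t _; rewrite -sum_pathP. Qed.

Variable U : St -> R.
(** Bellman residual of a candidate value function [U]. If it is nonnegative everywhere and zero for
    some fixed action, then [U] is the optimal value and this is the loss from playing [a] once. *)
Definition gap s a := U s - reward R s - gamma * \sum_s' P s a s' * U s'.
Definition mean_gap (pi : policy R d) h s := \sum_a pi h s a * gap s a.

Hypotheses (g0 : 0 <= gamma) (g1 : gamma < 1) (stP : stochastic P).
Hypotheses (gap0 : forall s a, 0 <= gap s a) (U0 : forall s, 0 <= U s).

Lemma mean_gap_ge0 (pi : policy R d) : is_policy pi -> forall h s, 0 <= mean_gap pi h s.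
Proof. by move=> ppi h s; apply: sumr_ge0 => a _; rewrite mulr_ge0 ?ppi.1. Qed.

Lemma mean_gapE (pi : policy R d) h s : is_policy pi ->
  reward R s = 1 * (U s - gamma * step P pi (fun _ => U) h s) + (-1) * mean_gap pi h s.
Proof.
move=> ppi.
have -> : mean_gap pi h s = U s - reward R s - gamma * step P pi (fun _ => U) h s.
  rewrite /mean_gap /gap.
  under eq_bigr => a _ do rewrite mulrDr mulrN mulrCA.
  by rewrite sumrB -mulr_suml ppi.2 mul1r -mulr_sumr.
ring.
Qed.

(** Performance difference identity truncated at [n]: the reward is the Bellman increment of [U]
    minus the gap, and the increments telescope. *)
Lemma partial_value (pi : policy R d) n h s : is_policy pi ->
  \sum_(i < n) gamma ^+ i * cond_reward T gamma sig pi h s i =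
  U s - \sum_(i < n) gamma ^+ i * iter i (step P pi) (mean_gap pi) h s
   - gamma ^+ n * iter n (step P pi) (fun _ => U) h s.
Proof.
move=> ppi; rewrite (iter_step_Bellman P pi U gamma n h s) addrAC addrK -sumrB.
apply: eq_bigr => i _; rewrite cond_rewardE.
rewrite (eq_iter_step _ _ _ _ _ (fun h s => mean_gapE pi h s ppi)) iter_stepD; ring.
Qed.

Lemma series_ordE (u : nat -> R) n : series u n = \sum_(i < n) u i.
Proof. by rewrite /series /= big_mkord. Qed.

(** Nonnegative terms are dropped: the remainder and the gaps after time [m]. Keeping [m] apart from
    [n] allows [n] to tend to infinity with [m] fixed. *)
Lemma partial_value_le (pi : policy R d) m n h s : is_policy pi -> (m <= n)%N ->
  \sum_(i < n) gamma ^+ i * cond_reward T gamma sig pi h s i <=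
  U s - \sum_(i < m) gamma ^+ i * iter i (step P pi) (mean_gap pi) h s.
Proof.
move=> ppi mn; rewrite partial_value //.
have H1 : 0 <= gamma ^+ n * iter n (step P pi) (fun _ => U) h s.
  by rewrite mulr_ge0 ?exprn_ge0 //; apply: iter_step_ge0.
suff H2 : \sum_(i < m) gamma ^+ i * iter i (step P pi) (mean_gap pi) h s <=
  \sum_(i < n) gamma ^+ i * iter i (step P pi) (mean_gap pi) h s by lra.
rewrite -!(big_mkord xpredT (fun i => gamma ^+ i * iter i (step P pi) (mean_gap pi) h s)).
rewrite (big_cat_nat (leq0n m) mn) //= lerDl; apply: sumr_ge0 => i _.
by rewrite mulr_ge0 ?exprn_ge0 //; apply: iter_step_ge0 => //; exact: mean_gap_ge0.
Qed.

(** Rewards are nonnegative, so the partial sums increase, and they are bounded by [U s]. *)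
Lemma is_cvg_Vpi (pi : policy R d) h s : is_policy pi ->
  cvgn (series (fun i : nat => gamma ^+ i * cond_reward T gamma sig pi h s i : R)).
Proof.
move=> ppi; apply: nondecreasing_is_cvgn.
  apply/nondecreasing_seqP => n; rewrite !series_ordE big_ord_recr /= lerDl.
  rewrite mulr_ge0 ?exprn_ge0 // cond_rewardE; apply: iter_step_ge0 => // _ [] //=.
exists (U s) => _ [n _ <-]; rewrite series_ordE.
by have := partial_value_le pi 0 n h s ppi (leq0n _); rewrite big_ord0 subr0.
Qed.

Lemma Vpi_le (pi : policy R d) m h s : is_policy pi ->
  Vpi T gamma sig pi h s <=
  U s - \sum_(i < m) gamma ^+ i * iter i (step P pi) (mean_gap pi) h s.
Proof.
move=> ppi; apply: limr_le; first exact: is_cvg_Vpi.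
by exists m => //= n mn; rewrite series_ordE; exact: partial_value_le.
Qed.

Lemma Vpi_greedy (pi : policy R d) h s : is_policy pi ->
  (forall h s, mean_gap pi h s = 0) -> U s <= Vpi T gamma sig pi h s.
Proof.
(* [B] bounds [U] on both states, so the remainder [gamma ^+ n * B] vanishes in the limit. *)
move=> ppi mg0; set B := U false + U true.
have UB s' : U s' <= B by case: s'; rewrite /B ?lerDl ?lerDr.
have cB : U s - gamma ^+ n * B @[n --> \oo] --> U s - 0 * B.
  apply: cvgB; first exact: cvg_cst.
  by apply: cvgMr_tmp; apply: cvg_expr; rewrite ger0_norm.
rewrite mul0r subr0 in cB; rewrite -[leLHS](cvg_lim _ cB) //.
apply: ler_lim; [by apply/cvg_ex; exists (U s)| exact: is_cvg_Vpi |].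
apply: nearW => n; rewrite series_ordE partial_value //.
rewrite [X in U s - X - _]big1 ?subr0; last first.
  move=> i _; rewrite (eq_iter_step _ _ _ _ _ (mg0)) (iter_step0 P pi i) ?mulr0 //.
by rewrite lerB // ler_wpM2l ?exprn_ge0 //; apply: iter_step_le.
Qed.

(** The policy that always plays [astar] attains [U]. The supremum is meaningful because [U s]
    bounds the value of every policy. *)
Lemma le_Vstar (astar : Act d) s : (forall s, gap s astar = 0) -> U s <= Vstar T gamma sig s.
Proof.
move=> ga; pose pi : policy R d := fun _ _ a => (a == astar)%:R.
have pE (f : Act d -> R) h s' : \sum_a pi h s' a * f a = f astar.
  rewrite (bigD1 astar) //= /pi eqxx mul1r big1 ?addr0 // => a /negbTE ->.
  by rewrite mul0r.
have ppi : is_policy pi.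
  split=> [h s' a|h s']; first by rewrite /pi ler0n.
  by rewrite -[RHS](pE (fun=> 1) h s'); apply: eq_bigr => a _; rewrite mulr1.
apply: (@le_trans _ _ (Vpi T gamma sig pi [::] s)).
  by apply: Vpi_greedy => // h s'; rewrite /mean_gap pE.
apply: ub_le_sup; last by exists pi.
exists (U s) => _ [pi' [ppi' ->]].
by have := Vpi_le pi' 0 [::] s ppi'; rewrite big_ord0 subr0.
Qed.

(** The weight of [e u] is the geometric sum of [gamma ^+ (u - t)] over [t <= u]. In the induction,
    raising [n] by one adds the terms with [t + i = n]. *)
Lemma double_sum_discount (e : nat -> R) n :
  (1 - gamma) * \sum_(t < n) \sum_(i < n - t) gamma ^+ i * e (t + i)%N =
  \sum_(u < n) (1 - gamma ^+ u.+1) * e u.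
Proof.
elim: n => [|n IH]; first by rewrite !big_ord0 mulr0.
rewrite [in RHS]big_ord_recr /= -IH.
under eq_bigr => t _.
  rewrite subSn ?big_ord_recr /= ?subnKC; first over.
  - by rewrite -ltnS.
  - by rewrite -ltnS.
rewrite big_split /= mulrDr big_ord_recr /= subnn big_ord0 addr0; congr (_ + _).
rewrite -mulr_suml mulrA; congr (_ * _).
rewrite (reindex_inj rev_ord_inj) /=.
rewrite [RHS](_ : _ = - (gamma ^+ n.+1 - 1)); last by rewrite opprB.
rewrite subrX1 -mulNr opprB; congr (_ * _); apply: eq_bigr => i _.
by rewrite subSS subKn // -ltnS.
Qed.

(** The regret at time [t] is at least the discounted expected gaps from [t] up to the horizon.
    Summed over [t], the gap at time [u] has weight [(1 - gamma ^+ u.+1) / (1 - gamma)]; as gaps are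
    at most 1, replacing the numerator by 1 costs at most a geometric series. *)
Lemma le_ExpRegret (pi : policy R d) (astar : Act d) : is_policy pi ->
  (forall s, gap s astar = 0) -> (forall s a, gap s a <= 1) ->
  (\sum_(u < T) iter u (step P pi) (mean_gap pi) [::] false - gamma / (1 - gamma)) /
    (1 - gamma) <= ExpRegret T gamma sig pi.
Proof.
move=> ppi ga gap1.
pose e u := iter u (step P pi) (mean_gap pi) [::] false.
apply: (@le_trans _ _ (\sum_(t < T) \sum_(i < T - t) gamma ^+ i * e (t + i)%N)); last first.
  rewrite ExpRegretE; apply: ler_sum => t _.
  apply: (@le_trans _ _ (iter t (step P pi) (fun h s =>
      \sum_(i < T - t) gamma ^+ i * iter i (step P pi) (mean_gap pi) h s) [::] false)).
    rewrite iter_step_sum; apply: ler_sum => i _.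
    rewrite -[X in iter t (step P pi) X](_ : (fun h s =>
      gamma ^+ i * iter i (step P pi) (mean_gap pi) h s +
      0 * iter i (step P pi) (mean_gap pi) h s) = _); last first.
      by apply/funext => h; apply/funext => s; rewrite mul0r addr0.
    by rewrite iter_stepD mul0r addr0 -iterD.
  apply: ler_iter_step => // h s.
  have := Vpi_le pi (T - t) h s ppi; have := le_Vstar astar s ga; lra.
have d0 : 0 < 1 - gamma by rewrite subr_gt0.
rewrite ler_pdivrMr // [leRHS]mulrC double_sum_discount.
have e1 u : e u <= 1.
  apply: iter_step_le => // h s; rewrite -(ppi.2 h s); apply: ler_sum => a _.
  by rewrite -[leRHS]mulr1 ler_wpM2l ?ppi.1.
have -> : \sum_(u < T) (1 - gamma ^+ u.+1) * e u =
   \sum_(u < T) e u - \sum_(u < T) gamma ^+ u.+1 * e u.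
  by rewrite -sumrB; apply: eq_bigr => u _; rewrite mulrBl mul1r.
rewrite lerB //; apply: (@le_trans _ _ (\sum_(u < T) gamma * gamma ^+ u)).
  apply: ler_sum => u _; rewrite -exprS -[leRHS]mulr1.
  by rewrite ler_wpM2l ?exprn_ge0.
rewrite -mulr_sumr ler_wpM2l // -[leRHS]mul1r ler_pdivlMr //.
have := subrX1 gamma T; have := exprn_ge0 T g0; lra.
Qed.

End PerformanceDifference.

(** * The family of MDPs *)

Lemma ln2_bounds {R : realType} : 1 / 2 <= ln 2 :> R /\ ln 2 <= 1 :> R.
Proof.
split; last by have := @le_ln1Dx R 1; rewrite (_ : 1 + 1 = 2) //; apply; lra.
have := @le_ln1Dx R (- (1 / 2)); rewrite (_ : 1 + - (1 / 2) = 2^-1); last by field.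
rewrite lnV ?posrE //; lra.
Qed.

Lemma expR_le_inv {R : realType} (z : R) : z < 1 -> expR z - 1 <= z / (1 - z).
Proof.
move=> z1; have := @expR_ge1Dx R (- z); rewrite expRN => H.
have e0 := expR_gt0 z.
have d0 : 0 < 1 - z by lra.
rewrite ler_pdivlMr //.
have : (1 - z) * expR z <= 1.
  by rewrite -ler_pdivlMr // mul1r.
nra.
Qed.

(** * The logistic function and the chi-square divergence of Bernoulli laws *)

Section Sigmoid.
Context {R : realType}.
Variable A : R.
Hypothesis A0 : 0 < A.

(** With [A = delta^-1 - 1] this is the probability of moving from [x_0] to [x_1] as a function of
    the inner product of action and parameter. *)
Definition sigmoid (y : R) := (1 + A * expR (- y))^-1.

Lemma sigmoid_den y : 0 < 1 + A * expR (- y).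
Proof. by rewrite addr_gt0 // mulr_gt0 // expR_gt0. Qed.

Lemma sigmoid_gt0 y : 0 < sigmoid y.
Proof. by rewrite invr_gt0 sigmoid_den. Qed.

Lemma sigmoid_subr1 y : 1 - sigmoid y = A * expR (- y) * sigmoid y.
Proof. by rewrite /sigmoid; field; rewrite gt_eqF // sigmoid_den. Qed.

Lemma sigmoid_lt1 y : sigmoid y < 1.
Proof. by rewrite -subr_gt0 sigmoid_subr1 !mulr_gt0 ?expR_gt0 ?sigmoid_gt0. Qed.

(** An exact formula rather than a derivative bound: it serves both the lower bound on the gaps and
    the upper bound on the divergence. *)
Lemma sigmoid_diff y y' :
  sigmoid y' - sigmoid y = sigmoid y * (1 - sigmoid y') * (expR (y' - y) - 1).
Proof.
have Ey : expR (- y) = expR (y' - y) * expR (- y').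
  by rewrite -expRD; congr expR; ring.
have := sigmoid_den y; have := sigmoid_den y'; rewrite sigmoid_subr1 /sigmoid Ey.
by move=> H1 H2; field; rewrite !gt_eqF.
Qed.

Lemma ler_sigmoid y y' : y <= y' -> sigmoid y <= sigmoid y'.
Proof.
move=> yy; rewrite -subr_ge0 sigmoid_diff mulr_ge0 //.
  by rewrite mulr_ge0 ?subr_ge0 // ltW ?sigmoid_gt0 ?sigmoid_lt1.
by rewrite subr_ge0 -expR0 ler_expR subr_ge0.
Qed.

Lemma sigmoid_diff_le y y' : `|sigmoid y' - sigmoid y| <=
  sigmoid y * (1 - sigmoid y) * (expR `|y' - y| - 1).
Proof.
have p0 := sigmoid_gt0; have p1 := sigmoid_lt1.
case: (leP y y') => yy.
  have le_p := ler_sigmoid _ _ yy.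
  rewrite (ger0_norm (_ : 0 <= y' - y)) ?subr_ge0 // ger0_norm ?subr_ge0 //.
  rewrite sigmoid_diff ler_wpM2r ?ler_wpM2l ?lerB ?(ltW (p0 _)) //.
  by rewrite subr_ge0 -expR0 ler_expR subr_ge0.
have le_p := ler_sigmoid _ _ (ltW yy).
rewrite distrC (distrC y').
rewrite (ger0_norm (_ : 0 <= y - y')) ?subr_ge0 ?(ltW yy) // ger0_norm ?subr_ge0 //.
rewrite sigmoid_diff ler_wpM2r ?ler_wpM2r ?subr_ge0 ?(ltW (p1 _)) //.
by rewrite -expR0 ler_expR subr_ge0 ltW.
Qed.

(** The left side is the second moment of a Bernoulli likelihood ratio, equal to
    [1 + (p' - p) ^+ 2 / (p * (1 - p))]; a factor [1 - p <= 1] is dropped at the end. *)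
Lemma sigmoid_chi2 y y' :
  sigmoid y' ^+ 2 / sigmoid y + (1 - sigmoid y') ^+ 2 / (1 - sigmoid y) <=
  1 + sigmoid y * (expR `|y' - y| - 1) ^+ 2.
Proof.
have := sigmoid_diff_le y y'; have := sigmoid_gt0 y; have := sigmoid_lt1 y.
have : 0 <= expR `|y' - y| - 1 by rewrite subr_ge0 -expR0 ler_expR.
move: (sigmoid y) (sigmoid y') (expR _ - 1) => p p' e e0 p1 p0 H.
have q0 : 0 < p * (1 - p) by rewrite mulr_gt0 // subr_gt0.
have -> : p' ^+ 2 / p + (1 - p') ^+ 2 / (1 - p) = 1 + (p' - p) ^+ 2 / (p * (1 - p)).
  by field; rewrite !gt_eqF // subr_gt0.
have pe : 0 <= p * (1 - p) * e by rewrite mulr_ge0 // ltW.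
rewrite lerD2l ler_pdivrMr //.
apply: (@le_trans _ _ ((p * (1 - p) * e) ^+ 2)).
  by rewrite -[leLHS]real_normK ?num_real // ler_sqr ?nnegrE.
rewrite (_ : (p * (1 - p) * e) ^+ 2 = p * e ^+ 2 * (p * (1 - p)) * (1 - p)); last ring.
rewrite -[leRHS]mulr1 ler_wpM2l //; last lra.
exact: mulr_ge0 (mulr_ge0 (ltW p0) (sqr_ge0 _)) (ltW q0).
Qed.

End Sigmoid.

(** * Sizes of [Delta] and [Deltabar] *)

Section HardInstance.
Context {R : realType} {d T : nat} {gamma : R}.
Hypotheses (d2 : (2 <= d)%N) (g100 : 100 / 101 <= gamma) (g1 : gamma < 1).
Hypothesis T45 : 45 * (d.-1)%:R ^+ 2 / (1 - gamma) <= T%:R.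

Let n : R := (d.-1)%:R.
Let dl := delta gamma.
Let D := Delta d T gamma.
Let x := Deltabar d T gamma.

Lemma dim_ge1 : 1 <= n.
Proof. by rewrite /n -[1]/(1%:R) ler_nat; case: d d2 => [|[]]. Qed.

Lemma delta_gt0 : 0 < dl.
Proof. by rewrite /dl /delta subr_gt0. Qed.

Lemma delta_le : dl <= 1 / 101.
Proof. rewrite /dl /delta; move: g100 => h; lra. Qed.

Lemma horizon_ge : 45 * n ^+ 2 <= T%:R * dl.
Proof. by rewrite -ler_pdivrMr // delta_gt0. Qed.

Lemma horizon_gt0 : 0 < T%:R :> R.
Proof.
rewrite -(pmulr_lgt0 _ delta_gt0); apply: lt_le_trans horizon_ge.
by rewrite mulr_gt0 // exprn_gt0 // (lt_le_trans _ dim_ge1).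
Qed.

Lemma Delta_gt0 : 0 < D.
Proof.
have [l _] := @ln2_bounds R; have T0 := horizon_gt0; have d0 := delta_gt0.
have n1 := dim_ge1.
rewrite divr_gt0 ?(lt_le_trans _ n1) // mulr_gt0 // sqrtr_gt0.
rewrite !mulr_gt0 // ?invr_gt0 //; lra.
Qed.

(** The constant is [45 ^+ 2 * (2 / 5) = 810]. The two bounds that follow use
    [1 / 2 <= ln 2 <= 1]. *)
Lemma sqr_Delta : 810 * T%:R * ln 2 * D ^+ 2 = n ^+ 2 * dl.
Proof.
have [l _] := @ln2_bounds R; have T0 := horizon_gt0; have d0 := delta_gt0.
have l0 : 0 < ln 2 :> R by lra.
rewrite /D /Delta expr_div_n exprMn sqr_sqrtr; last first.
  by rewrite !mulr_ge0 // ltW // invr_gt0.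
rewrite -/n -/dl; field.
by rewrite !gt_eqF.
Qed.

Lemma Delta_sqr_le : 405 * T%:R * D ^+ 2 <= n ^+ 2 * dl.
Proof.
have [l _] := @ln2_bounds R; have T0 := horizon_gt0.
rewrite -sqr_Delta; have : 0 <= T%:R * D ^+ 2 * (ln 2 - 1 / 2).
  by apply: mulr_ge0; [rewrite mulr_ge0 ?sqr_ge0 | lra].
lra.
Qed.

Lemma Delta_ge : n * Num.sqrt dl <= 30 * D * Num.sqrt T%:R.
Proof.
have [_ l] := @ln2_bounds R; have T0 := horizon_gt0; have d0 := delta_gt0.
have n1 := dim_ge1; have D0 := Delta_gt0.
have n0 : 0 <= n by rewrite (le_trans _ n1).
rewrite -ler_sqr ?nnegrE; last 2 first.
- by rewrite mulr_ge0 ?sqrtr_ge0.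
- by rewrite mulr_ge0 ?sqrtr_ge0 // (mulr_ge0 _ (ltW D0)).
rewrite [leLHS]exprMn [leRHS]exprMn (exprMn _ 30) !sqr_sqrtr ?(ltW T0) ?(ltW d0) // -sqr_Delta.
rewrite (_ : 30 ^+ 2 = 900); last by ring.
have : 0 <= T%:R * D ^+ 2 * (900 - 810 * ln 2).
  by apply: mulr_ge0; [rewrite mulr_ge0 ?sqr_ge0 | lra].
lra.
Qed.

(** The lower bound on the horizon enters here: [405 * 45 = 135 ^+ 2]. *)
Lemma Delta_le : 135 * D <= dl.
Proof.
have d0 := delta_gt0; have n1 := dim_ge1; have D0 := Delta_gt0.
have H1 := Delta_sqr_le; have H2 := horizon_ge.
have n0 : 0 < n ^+ 2 by rewrite exprn_gt0 // (lt_le_trans _ n1).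
rewrite -ler_sqr ?nnegrE ?(ltW d0) //; last exact: mulr_ge0 (ltW D0).
rewrite [leLHS]exprMn.
rewrite -(ler_pM2l n0).
have : 405 * (45 * n ^+ 2) * D ^+ 2 <= 405 * (T%:R * dl) * D ^+ 2.
  by rewrite ler_wpM2r ?sqr_ge0 // ler_wpM2l.
have := ler_wpM2r (ltW d0) H1; lra.
Qed.

Lemma expR_Deltabar : expR x = (1 - dl) * (dl + D) / (dl * (1 - dl - D)).
Proof.
have d0 := delta_gt0; have d1 := delta_le; have D0 := Delta_gt0.
have D1 := Delta_le.
rewrite /x /Deltabar lnK // posrE divr_gt0 // mulr_gt0 // -/dl -/D; lra.
Qed.

Lemma expR_Deltabar_sub1 : dl * (1 - dl - D) * (expR x - 1) = D.
Proof.
have d0 := delta_gt0; have d1 := delta_le; have D0 := Delta_gt0.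
have D1 := Delta_le.
rewrite expR_Deltabar; field; rewrite !gt_eqF //; lra.
Qed.

Lemma Deltabar_gt0 : 0 < x.
Proof.
have d0 := delta_gt0; have d1 := delta_le; have D0 := Delta_gt0.
have D1 := Delta_le; rewrite -expR_gt1 -subr_gt0.
have : 0 < dl * (1 - dl - D) * (expR x - 1) by rewrite expR_Deltabar_sub1.
by rewrite pmulr_rgt0 // mulr_gt0 //; lra.
Qed.

Lemma Deltabar_le : dl * (1 - dl - D) * x <= D.
Proof.
have d0 := delta_gt0; have d1 := delta_le; have D0 := Delta_gt0.
have D1 := Delta_le; rewrite -[leRHS]expR_Deltabar_sub1 ler_wpM2l //.
  by rewrite mulr_ge0 //; lra.
have := expR_ge1Dx x; lra.
Qed.

Lemma Deltabar_le_const : x <= 1 / 100.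
Proof.
have d0 := delta_gt0; have d1 := delta_le; have D0 := Delta_gt0.
have D1 := Delta_le; have H := Deltabar_le; have x0 := Deltabar_gt0.
have : dl * (9 / 10) * x <= dl * (1 - dl - D) * x.
  rewrite ler_wpM2r ?(ltW x0) // ler_wpM2l ?(ltW d0) //; lra.
move=> H2; have : dl * x <= dl * (1 / 100) by lra.
by rewrite ler_pM2l.
Qed.

(** Together with [Deltabar_le], this pins [x] to [D / (dl * (1 - dl - D))] up to a factor
    [1 - x]. *)
Lemma Deltabar_ge : D * (1 - x) <= dl * (1 - dl - D) * x.
Proof.
have d0 := delta_gt0; have d1 := delta_le; have D0 := Delta_gt0.
have D1 := Delta_le; have x1 := Deltabar_le_const.
have x1' : 0 < 1 - x by lra.
have q0 : 0 <= dl * (1 - dl - D) by rewrite mulr_ge0 //; lra.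
have := ler_wpM2l q0 (expR_le_inv x _); rewrite expR_Deltabar_sub1 mulrA.
by rewrite ler_pdivlMr //; apply; lra.
Qed.


(** * Signs, inner products and transition probabilities *)

Lemma odds_gt0 : 0 < dl^-1 - 1.
Proof.
have d0 := delta_gt0; have d1 := delta_le.
by rewrite subr_gt0 invf_gt1 //; lra.
Qed.

Lemma alpha_gt0 : 0 < alpha d T gamma.
Proof.
have x0 := Deltabar_gt0; have n1 := dim_ge1.
rewrite sqrtr_gt0 divr_gt0 // -/n -/x mulr_gt0 //; lra.
Qed.

Lemma beta_gt0 : 0 < beta d T gamma.
Proof.
by have x0 := Deltabar_gt0; rewrite sqrtr_gt0 divr_gt0 // -/x; lra.
Qed.

Definition inner (sig a : Act d) : R := \sum_i avec R a i * theta T gamma sig i.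

Definition hamming (sig a : Act d) : R := \sum_i (a i != sig i)%:R.

Definition flip (j : 'I_d.-1) (sig : Act d) : Act d :=
  [ffun i => if i == j then ~~ sig i else sig i].

(** Each wrong sign turns a contribution [x / n] into its opposite. *)
Lemma innerE sig a : inner sig a = x - 2 * (x / n) * hamming sig a.
Proof.
have n1 := dim_ge1; have n0 : n != 0 by rewrite gt_eqF // (lt_le_trans _ n1).
have {1}-> : x = \sum_(i < d.-1) x / n.
  by rewrite sumr_const card_ord -[_ *+ _]mulr_natr -/n mulfVK.
rewrite mulr_sumr -sumrB; apply: eq_bigr => i _.
rewrite /avec /theta /sgn -/x -/n; case: (a i); case: (sig i) => /=; lra.
Qed.

Lemma hamming_ge0 sig a : 0 <= hamming sig a.
Proof. by apply: sumr_ge0 => i _; rewrite ler0n. Qed.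

Lemma hamming_id sig : hamming sig sig = 0.
Proof. by apply: big1 => i _; rewrite eqxx. Qed.

Lemma hamming_le sig a : hamming sig a <= n.
Proof.
rewrite /n -[d.-1]card_ord -sum1_card natr_sum; apply: ler_sum => i _.
by rewrite ler_nat leq_b1.
Qed.

Lemma flipK j : involutive (flip j).
Proof.
by move=> sig; apply/ffunP => i; rewrite !ffunE; case: (i == j); rewrite ?negbK.
Qed.

Lemma inner_flip j sig a : `|inner (flip j sig) a - inner sig a| = 2 * (x / n).
Proof.
have x0 := Deltabar_gt0; have n1 := dim_ge1.
have xn0 : 0 < x / n by rewrite divr_gt0 // (lt_le_trans _ n1).
rewrite /inner -sumrB (bigD1 j) //= big1 ?addr0; last first.
  by move=> i /negbTE ij; rewrite /theta ffunE ij subrr.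
rewrite /avec /theta /sgn ffunE eqxx -/x -/n.
by case: (a j); case: (sig j) => /=; (rewrite ger0_norm; [lra | lra]) || (rewrite ler0_norm; [lra | lra]).
Qed.

Lemma dotd_x0 (sig a : Act d) :
  dotd (phi T gamma false a false) (thetabar T gamma sig) = - inner sig a + ln (dl^-1 - 1).
Proof.
rewrite /dotd /= /inner -sumrN; congr (_ + _).
  apply: eq_bigr => i _; field; rewrite gt_eqF //; exact: alpha_gt0.
by rewrite -/dl; field; rewrite gt_eqF //; exact: beta_gt0.
Qed.

Lemma dotd_x1 (sig a : Act d) :
  dotd (phi T gamma true a true) (thetabar T gamma sig) = ln (dl^-1 - 1).
Proof.
rewrite /dotd /= big1 ?add0r; last by move=> i _; rewrite mul0r.
by rewrite -/dl; field; rewrite gt_eqF //; exact: beta_gt0.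
Qed.

Lemma dotd_cross (sig a : Act d) s :
  dotd (phi T gamma s a (~~ s)) (thetabar T gamma sig) = 0.
Proof.
by case: s; rewrite /dotd /= mul0r addr0 big1 // => i _; rewrite mul0r.
Qed.

Lemma trans_x0_x1 (sig a : Act d) :
  trans T gamma sig false a true = sigmoid (dl^-1 - 1) (inner sig a).
Proof.
rewrite /trans big_bool dotd_x0 (dotd_cross sig a false) expRD lnK ?posrE ?odds_gt0 //.
by rewrite expR0 div1r /sigmoid (mulrC (expR _)).
Qed.

Lemma trans_x1_x0 (sig a : Act d) : trans T gamma sig true a false = dl.
Proof.
rewrite /trans big_bool dotd_x1 (dotd_cross sig a true) lnK ?posrE ?odds_gt0 //.
by rewrite expR0 /= subrK div1r invrK.
Qed.

Lemma trans_gt0 (sig : Act d) s a s' : 0 < trans T gamma sig s a s'.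
Proof. by rewrite /trans divr_gt0 ?expR_gt0 // big_bool addr_gt0 ?expR_gt0. Qed.

Lemma stochastic_trans (sig : Act d) : stochastic (trans T gamma sig).
Proof.
split=> [s a s'|s a]; first by rewrite ltW // trans_gt0.
rewrite /trans -mulr_suml divff // gt_eqF // big_bool addr_gt0 ?expR_gt0 //.
Qed.

Lemma trans_x0_x0 (sig a : Act d) : trans T gamma sig false a false = 1 - trans T gamma sig false a true.
Proof. by have := (stochastic_trans sig).2 false a; rewrite big_bool /= => <-; rewrite addrC addrK. Qed.

Lemma trans_x1_x1 (sig a : Act d) : trans T gamma sig true a true = 1 - dl.
Proof.
by have := (stochastic_trans sig).2 true a; rewrite big_bool /= trans_x1_x0 => <-; rewrite addrK.
Qed.

(** This is the reason for the formula of [Deltabar]: it is the shift of log-odds that takes the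
    probability from [dl] to [dl + D]. *)
Lemma sigmoid_Deltabar : sigmoid (dl^-1 - 1) x = dl + D.
Proof.
have d0 := delta_gt0; have d1 := delta_le; have D0 := Delta_gt0.
have D1 := Delta_le.
rewrite /sigmoid expRN expR_Deltabar; field.
rewrite !gt_eqF //; lra.
Qed.

Lemma hit_prob_le (sig a : Act d) : trans T gamma sig false a true <= dl + D.
Proof.
have x0 := Deltabar_gt0; have n1 := dim_ge1; have A0 := odds_gt0.
rewrite trans_x0_x1 -sigmoid_Deltabar ler_sigmoid // innerE gerBl.
by rewrite !mulr_ge0 ?hamming_ge0 // ?invr_ge0 ?(ltW x0) // (le_trans _ n1).
Qed.

Lemma hit_prob_opt (sig : Act d) : trans T gamma sig false sig true = dl + D.
Proof. by rewrite trans_x0_x1 innerE hamming_id mulr0 subr0 sigmoid_Deltabar. Qed.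

(** With [k] the fraction of wrong signs, [sigmoid_diff] and [Deltabar_ge] give a deficit of at
    least [2 * (1 - x) ^+ 2 * D * k]. Since [x <= 1 / 100], the constant exceeds 1. *)
Lemma hit_prob_gap (sig a : Act d) :
  D / n * hamming sig a <= dl + D - trans T gamma sig false a true.
Proof.
have x0 := Deltabar_gt0; have n1 := dim_ge1; have A0 := odds_gt0.
have d0 := delta_gt0; have d1 := delta_le; have D0 := Delta_gt0.
have D1 := Delta_le; have x1 := Deltabar_le_const; have xD := Deltabar_ge.
have h0 := hamming_ge0 sig a; have h1 := hamming_le sig a.
have n0 : 0 < n by rewrite (lt_le_trans _ n1).
set y := inner sig a.
set k := hamming sig a / n.
have k0 : 0 <= k by rewrite divr_ge0 ?(ltW n0).
have k1 : k <= 1 by rewrite ler_pdivrMr // mul1r.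
have yE : y = x - 2 * x * k by rewrite /y innerE /k; field; rewrite gt_eqF.
rewrite trans_x0_x1 -sigmoid_Deltabar sigmoid_diff // sigmoid_Deltabar -/y.
have -> : D / n * hamming sig a = D * k by rewrite /k mulrAC mulrA.
(* The worst case is [y = - x], all signs wrong, where the probability is at least [dl / expR x]. *)
have py : (1 - x) * dl <= sigmoid (dl^-1 - 1) y.
  have : - x <= y by have := mulr_ge0 (ltW x0) k0; have := ler_wpM2l (ltW x0) k1; lra.
  move=> /(ler_sigmoid _ A0); apply: le_trans.
  rewrite /sigmoid opprK.
  have e0 := expR_gt0 x; have := expR_ge1Dx (- x); rewrite expRN => ex.
  have e1 : 1 <= expR x by have := expR_ge1Dx x; lra.
  apply: (@le_trans _ _ ((expR x)^-1 * dl)).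
    by apply: ler_wpM2r; [exact: ltW | lra].
  have i0 : 0 < dl^-1 by rewrite invr_gt0.
  rewrite -{1}[dl]invrK -[leLHS]invfM lef_pV2 ?posrE.
  - lra.
  - by rewrite mulr_gt0.
  - by rewrite addr_gt0 // mulr_gt0.
have ey : 2 * x * k <= expR (x - y) - 1.
  by have := expR_ge1Dx (x - y); rewrite yE; lra.
have q0 : 0 <= 1 - (dl + D) by lra.
have : (1 - x) * dl * (1 - (dl + D)) * (2 * x * k) <=
   sigmoid (dl^-1 - 1) y * (1 - (dl + D)) * (expR (x - y) - 1).
  apply: ler_pM => //.
  - by rewrite !mulr_ge0 ?(ltW d0) //; lra.
  - by rewrite mulr_ge0 // mulr_ge0 // ltW.
  - exact: ler_wpM2r.
apply: le_trans.
have H1 : (1 - x) * (2 * k) * (D * (1 - x)) <= (1 - x) * (2 * k) * (dl * (1 - dl - D) * x).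
  by apply: ler_wpM2l => //; apply: mulr_ge0; lra.
have H2 : 0 <= (D * k) * (2 * (1 - x) ^+ 2 - 1).
  rewrite mulr_ge0 ?(mulr_ge0 (ltW D0) k0) //.
  have : 0 <= (1 / 100 - x) * (2 - x) by apply: mulr_ge0; lra.
  have : 0 <= (1 / 100 - x) * x by apply: mulr_ge0; lra.
  lra.
lra.
Qed.

(** From [x_1] the two MDPs agree. From [x_0] the inner product moves by [2 * (x / n)], so the
    excess is about [dl * (2 * x / n) ^+ 2]. As [dl * x] is about [D], this is about
    [4 * D ^+ 2 / (n ^+ 2 * dl)], at most [4 / (405 * T)]; the rest of [1 / (90 * T)] absorbs the
    approximations. *)
Lemma chi2_trans (sig : Act d) j s a :
  \sum_s' trans T gamma sig s a s' ^+ 2 / trans T gamma (flip j sig) s a s' <=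
  1 + 1 / (90 * T%:R).
Proof.
have x0 := Deltabar_gt0; have n1 := dim_ge1; have A0 := odds_gt0.
have d0 := delta_gt0; have d1 := delta_le; have D0 := Delta_gt0.
have D1 := Delta_le; have x1 := Deltabar_le_const; have xD := Deltabar_le.
have T0 := horizon_gt0; have DT := Delta_sqr_le.
have n0 : 0 < n by rewrite (lt_le_trans _ n1).
have ? : 0 <= 1 / (90 * T%:R) :> R by rewrite divr_ge0 // mulr_ge0 // ltW.
rewrite big_bool /=; case: s.
  rewrite !trans_x1_x1 !trans_x1_x0.
  rewrite expr2 mulfK ?expr2 ?mulfK ?gt_eqF //; lra.
have p1 := hit_prob_le (flip j sig) a; move: p1.
rewrite !trans_x0_x0 !trans_x0_x1 => p1.
apply: le_trans (sigmoid_chi2 _ A0 _ _) _; rewrite distrC inner_flip lerD2l.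
set z := 2 * (x / n).
have z0 : 0 <= z by rewrite mulr_ge0 ?divr_ge0 ?(ltW x0) ?(ltW n0).
have xn : x / n <= x by rewrite ler_pdivrMr // ler_peMr // ltW.
have z1 : z <= 1 / 50 by rewrite /z; lra.
have ez0 : 0 <= expR z - 1 by have := expR_ge1Dx z; lra.
have ez : expR z - 1 <= z * (50 / 49).
  apply: le_trans (expR_le_inv z _) _; first lra.
  apply: ler_wpM2l => //; rewrite -[leRHS]invrK lef_pV2 ?posrE ?invr_gt0 //; lra.
have xd : dl * x <= 102 / 100 * D.
  have : dl * (981 / 1000) * x <= dl * (1 - dl - D) * x.
    rewrite ler_wpM2r ?(ltW x0) // ler_wpM2l ?(ltW d0) //; lra.
  lra.
have s0 : 0 <= sigmoid (dl^-1 - 1) (inner (flip j sig) a) by rewrite ltW // sigmoid_gt0.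
(* The factor [136 / 135] comes from [135 * D <= dl], and [50 / 49] from [z <= 1 / 50]. *)
apply: (@le_trans _ _ (dl * (136 / 135) * (z * (50 / 49)) ^+ 2)).
  apply: ler_pM => //; [exact: sqr_ge0 | lra |].
  by rewrite ler_sqr ?nnegrE // mulr_ge0 // divr_ge0.
have nz : n * z = 2 * x by rewrite /z; field; rewrite gt_eqF.
have k0 : 0 < n ^+ 2 * dl by rewrite mulr_gt0 // exprn_gt0.
rewrite ler_pdivlMr ?mulr_gt0 // -(ler_pM2l k0).
have -> : n ^+ 2 * dl * (dl * (136 / 135) * (z * (50 / 49)) ^+ 2 * (90 * T%:R)) =
  (136 / 135) * (50 / 49) ^+ 2 * 90 * T%:R * (dl * (n * z)) ^+ 2 by field.
rewrite nz.
have : (dl * (2 * x)) ^+ 2 <= (204 / 100 * D) ^+ 2.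
  rewrite ler_sqr ?nnegrE; [lra | |].
    by rewrite !mulr_ge0 ?(ltW x0) ?(ltW d0).
  by rewrite mulr_ge0 ?(ltW D0) // divr_ge0.
have c0 : 0 <= 136 / 135 * (50 / 49) ^+ 2 * 90 * T%:R :> R.
  by apply: mulr_ge0 (ltW T0); lra.
move=> /(ler_wpM2l c0) H; apply: le_trans H _; rewrite mulr1.
apply: le_trans DT; rewrite [(204 / 100 * D) ^+ 2]exprMn.
have : 0 <= T%:R * D ^+ 2 by rewrite mulr_ge0 ?sqr_ge0 // ltW.
lra.
Qed.

(** * Norms of the parameters and of the features *)

Lemma L_theta_le (sig : Act d) : L_theta T gamma sig <= 100 / 99.
Proof.
have x0 := Deltabar_gt0; have n1 := dim_ge1; have x1 := Deltabar_le_const.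
have n0 : 0 < n by rewrite (lt_le_trans _ n1).
have a0 := alpha_gt0; have b0 := beta_gt0.
have a2 : alpha d T gamma ^+ 2 = x / (n * (1 + x)).
  rewrite sqr_sqrtr // divr_ge0 ?(ltW x0) // mulr_ge0 ?(ltW n0) // -/x; lra.
have b2 : beta d T gamma ^+ 2 = 1 / (1 + x).
  rewrite sqr_sqrtr // divr_ge0 // -/x; lra.
rewrite /L_theta /norm2 /=.
(* The last coordinate contributes [1 + x], so the squared norm is [(1 + x) ^+ 2], and
   [1 + x <= 101 / 100]. *)
have -> : \sum_(i < d.-1) (theta T gamma sig i / alpha d T gamma) ^+ 2 = x * (1 + x).
  under eq_bigr => i _.
    rewrite expr_div_n a2 (_ : theta T gamma sig i ^+ 2 = (x / n) ^+ 2); first over.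
    rewrite /theta -/x -/n /sgn; case: (sig i); ring.
  rewrite sumr_const card_ord -[_ *+ _]mulr_natr -/n; field.
  rewrite !gt_eqF //; lra.
rewrite expr_div_n b2 (_ : x * (1 + x) + 1 ^+ 2 / (1 / (1 + x)) = (1 + x) ^+ 2); last first.
  field; rewrite gt_eqF //; lra.
rewrite sqrtr_sqr ger0_norm; lra.
Qed.

Lemma L_phi_le : L_phi d T gamma <= 1 + ln (gamma / (1 - gamma)).
Proof.
have x0 := Deltabar_gt0; have n1 := dim_ge1; have x1 := Deltabar_le_const.
have d0 := delta_gt0; have d1 := delta_le.
have n0 : 0 < n by rewrite (lt_le_trans _ n1).
have a2 : alpha d T gamma ^+ 2 = x / (n * (1 + x)).
  rewrite sqr_sqrtr // divr_ge0 ?(ltW x0) // mulr_ge0 ?(ltW n0) // -/x; lra.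
have b2 : beta d T gamma ^+ 2 = 1 / (1 + x).
  rewrite sqr_sqrtr // divr_ge0 // -/x; lra.
have -> : gamma / (1 - gamma) = dl^-1 - 1.
  by rewrite /dl /delta; field; rewrite gt_eqF // subr_gt0.
set l := ln (dl^-1 - 1).
have l0 : 0 <= l.
  apply: ln_ge0; have : 100 < dl^-1 by rewrite -ltf_pV2 ?posrE ?invrK ?invr_gt0 //; lra.
  lra.
have i0 : 0 <= (1 + x)^-1 by rewrite invr_ge0; lra.
have i1 : (1 + x)^-1 <= 1 by rewrite invf_le1; lra.
have xi : x / (1 + x) <= 1 by rewrite ler_pdivrMr ?mul1r; lra.
(* Here [u] is the squared norm of the first [d - 1] coordinates: [x / (1 + x)] for the loop at
   [x_0], zero for the loop at [x_1]. The bound is [1 + l ^+ 2 <= (1 + l) ^+ 2]. *)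
have key (u : R) : 0 <= u <= 1 ->
  Num.sqrt (u + (beta d T gamma * ln (dl^-1 - 1)) ^+ 2) <= 1 + l.
  move=> /andP[u0 u1]; rewrite -[leRHS]ger0_norm; last lra.
  rewrite -sqrtr_sqr ler_sqrt; last exact: sqr_ge0.
  rewrite exprMn b2 -/l div1r.
  have := ler_wpM2r (sqr_ge0 l) i1; lra.
rewrite /L_phi; apply: bigmax_le => [|s _]; first lra.
apply: bigmax_le => [|a _]; first lra.
apply: bigmax_le => [|s' _]; first lra.
rewrite /norm2; case: s; case: s' => /=.
- by rewrite big1 ?key ?lexx ?ler01 // => i _; rewrite expr0n.
- by rewrite big1 => [|i _]; rewrite ?expr0n ?addr0 ?sqrtr0 //; lra.
- by rewrite big1 => [|i _]; rewrite ?expr0n ?addr0 ?sqrtr0 //; lra.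
- under eq_bigr => i _.
    rewrite (_ : (- alpha d T gamma * avec R a i) ^+ 2 = x / (n * (1 + x))); first over.
    rewrite -a2 /avec /sgn; case: (a i); ring.
  rewrite sumr_const card_ord -[_ *+ _]mulr_natr -/n.
  rewrite (_ : x / (n * (1 + x)) * n = x / (1 + x)); last first.
    field; rewrite !gt_eqF //; lra.
  by apply: key; rewrite xi divr_ge0 //; lra.
Qed.

(** * Optimal values and gaps *)

Let W : R := (1 - gamma * (1 - 2 * dl - D))^-1.

(* The solution of the Bellman optimality equations; [W] is its value at [x_1]
   minus its value at [x_0]. *)
Definition Vopt (s : St) : R := gamma * (dl + D) * W / dl + (if s then W else 0).

Lemma gammaE : gamma = 1 - dl.
Proof. by rewrite /dl /delta; lra. Qed.

Lemma gamma_ge0 : 0 <= gamma.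
Proof. have := delta_le; have := gammaE; rewrite -/dl; lra. Qed.

(** With [gamma = 1 - dl] the denominator is [3 * dl + D - 2 * dl ^+ 2 - dl * D], so [W] is of order
    [1 / (3 * dl)]. *)
Lemma W_den_bounds : 5 / 2 * dl <= 1 - gamma * (1 - 2 * dl - D) <= 4 * dl.
Proof.
have d0 := delta_gt0; have d1 := delta_le; have D0 := Delta_gt0.
have D1 := Delta_le; rewrite -/dl -/D in d0 d1 D0 D1.
rewrite {1 2}gammaE.
have a : dl * dl <= 1 / 101 * dl by rewrite ler_wpM2r // ltW.
have a0 : 0 <= dl * dl by rewrite mulr_ge0 // ltW.
have b : dl * D <= 1 / 101 * D by rewrite ler_wpM2r // ltW.
have b0 : 0 <= dl * D by rewrite mulr_ge0 // ltW.
apply/andP; split; lra.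
Qed.

Lemma W_gt0 : 0 < W.
Proof.
have := W_den_bounds; have := delta_gt0; rewrite -/dl invr_gt0; lra.
Qed.

Lemma W_le : 5 / 2 * dl * W <= 1.
Proof.
have /andP[H _] := W_den_bounds; have := W_gt0; rewrite invr_gt0 => W0.
by rewrite /W ler_pdivrMr // mul1r.
Qed.

Lemma W_ge : 1 <= 4 * dl * W.
Proof.
have /andP[_ H] := W_den_bounds; have := W_gt0; rewrite invr_gt0 => W0.
by rewrite /W ler_pdivlMr // mul1r.
Qed.

Lemma Vopt_ge0 s : 0 <= Vopt s.
Proof.
have W0 := W_gt0; have d0 := delta_gt0; have D0 := Delta_gt0.
rewrite addr_ge0 //; last by case: s => //; exact: ltW.
apply: divr_ge0 (ltW d0); apply: mulr_ge0 (ltW W0); apply: mulr_ge0 gamma_ge0 _.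
by apply: addr_ge0; exact: ltW.
Qed.

Lemma gap_x1 (sig : Act d) a : gap T gamma sig Vopt true a = 0.
Proof.
have W0 := W_gt0; have d0 := delta_gt0; rewrite -/dl in d0.
have WE : W * (1 - gamma * (1 - 2 * dl - D)) = 1.
  by rewrite mulVf // gt_eqF // -invr_gt0.
rewrite /gap big_bool /= trans_x1_x1 trans_x1_x0 /Vopt -/dl /reward.
have := divfK (lt0r_neq0 d0) (gamma * (dl + D) * W).
set V := _ / dl => VE.
transitivity (V * dl + W - 1 - gamma * (1 - dl) * W); last by rewrite VE; lra.
by rewrite {3}/dl /delta; ring.
Qed.

(** The loss is the missing probability of reaching [x_1] times the discounted advantage [W] of
    [x_1] over [x_0]. *)
Lemma gap_x0 (sig : Act d) a :
  gap T gamma sig Vopt false a = gamma * W * (dl + D - trans T gamma sig false a true).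
Proof.
have d0 := delta_gt0; rewrite -/dl in d0.
rewrite /gap big_bool /= trans_x0_x0 /Vopt /reward.
have := divfK (lt0r_neq0 d0) (gamma * (dl + D) * W).
set V := _ / dl => VE.
transitivity (V * dl - gamma * W * trans T gamma sig false a true).
  by rewrite {1}/dl /delta; ring.
rewrite VE; ring.
Qed.

Lemma gap_ge0 (sig : Act d) s a : 0 <= gap T gamma sig Vopt s a.
Proof.
case: s; first by rewrite gap_x1.
rewrite gap_x0 mulr_ge0 ?subr_ge0 ?hit_prob_le // mulr_ge0 ?gamma_ge0 //.
exact: ltW W_gt0.
Qed.

Lemma gap_le1 (sig : Act d) s a : gap T gamma sig Vopt s a <= 1.
Proof.
case: s; first by rewrite gap_x1.
have d0 := delta_gt0; have D0 := Delta_gt0; have D1 := Delta_le; have W0 := W_gt0.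
rewrite -/dl -/D in d0 D0 D1.
rewrite gap_x0 -mulrA -[leRHS]mul1r ler_pM ?gamma_ge0 //.
- by rewrite mulr_ge0 ?(ltW W0) // subr_ge0 hit_prob_le.
- exact: ltW.
apply: le_trans W_le; rewrite mulrC ler_wpM2r ?(ltW W0) //.
have := trans_gt0 sig false a true; lra.
Qed.

Lemma gap_opt (sig : Act d) s : gap T gamma sig Vopt s sig = 0.
Proof. by case: s; rewrite ?gap_x1 // gap_x0 hit_prob_opt subrr mulr0. Qed.

(** * Wrong signs played by a fixed policy, averaged over the parameters *)

Section Policy.
Variable pi : policy R d.
Hypothesis ppi : is_policy pi.

(** Set to zero in [x_1], where all actions have gap zero. *)
Definition wrong_sign (sig : Act d) j (h : seq (St * Act d)) (s : St) : R :=
  if s then 0 else \sum_a pi h s a * (a j != sig j)%:R.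

Lemma wrong_sign_ge0 sig j h s : 0 <= wrong_sign sig j h s.
Proof.
by case: s => //; apply: sumr_ge0 => a _; rewrite mulr_ge0 ?ppi.1 ?ler0n.
Qed.

(** Every action has its [j]-th sign wrong for exactly one of [sig] and [flip j sig]. *)
Lemma wrong_sign_flip sig j h s : wrong_sign sig j h s + wrong_sign (flip j sig) j h s = (~~ s)%:R.
Proof.
case: s => /=; first by rewrite addr0.
rewrite -big_split -[RHS](ppi.2 h false); apply: eq_bigr => a _ /=.
by rewrite -mulrDr ffunE eqxx; case: (a j); case: (sig j) => /=; rewrite ?addr0 ?add0r mulr1.
Qed.

Lemma mean_gap_ge sig h s :
  gamma * W * (D / n) * \sum_j wrong_sign sig j h s <= mean_gap T gamma sig Vopt pi h s.
Proof.
case: s; rewrite /mean_gap /wrong_sign.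
  by rewrite big1 // mulr0 sumr_ge0 // => a _; rewrite gap_x1 mulr0.
rewrite exchange_big mulr_sumr; apply: ler_sum => a _ /=.
rewrite -mulr_sumr [leLHS]mulrCA; apply: ler_wpM2l; first exact: ppi.1.
rewrite gap_x0 -[leLHS]mulrA; apply: ler_wpM2l; last exact: hit_prob_gap.
exact: mulr_ge0 gamma_ge0 (ltW W_gt0).
Qed.

(** The probability [q] of being in [x_0] becomes at least [dl + (1 - 2 * dl - D) * q] after one
    step. The fixed point [dl / (2 * dl + D)] is at least [135 / 271], above [49 / 100], and the
    chain starts in [x_0]. *)
Lemma visits_ge sig u :
  49 / 100 <= iter u (step (trans T gamma sig) pi) (fun _ s => (~~ s)%:R) [::] false.
Proof.
have d0 := delta_gt0; have d1 := delta_le; have D0 := Delta_gt0.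
have D1 := Delta_le; rewrite -/dl -/D in d0 d1 D0 D1.
have st := stochastic_trans sig.
elim: u => [|u IH]; first by rewrite /=; lra.
(* The last transition is peeled off, not the first, so the induction keeps the initial state. *)
rewrite iterSr.
have step_ge h (s : St) : dl * 1 + (1 - 2 * dl - D) * (~~ s)%:R <=
    step (trans T gamma sig) pi (fun _ s => (~~ s)%:R) h s.
  rewrite /step -[leLHS]mul1r -{1}(ppi.2 h s) mulr_suml; apply: ler_sum => a _.
  apply: ler_wpM2l; first exact: ppi.1.
  rewrite big_bool /=; case: s => /=; first by rewrite trans_x1_x0 -/dl; lra.
  by have := hit_prob_le sig a; rewrite trans_x0_x0 -/dl -/D; lra.
apply: le_trans (ler_iter_step _ _ st ppi u _ _ step_ge [::] false).
rewrite iter_stepD iter_step_cst //.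
have k0 : 0 <= 1 - 2 * dl - D by lra.
have := ler_wpM2l k0 IH; lra.
Qed.

(** The power is at most [expR (1 / 90)], whatever the horizon. *)
Lemma likelihood_bound u : (u <= T)%N -> (1 + 1 / (90 * T%:R)) ^+ u <= 90 / 89 :> R.
Proof.
move=> uT; have T0 := horizon_gt0.
have q0 : 0 <= 1 / (90 * T%:R) :> R by rewrite divr_ge0 // mulr_ge0 // ltW.
apply: (@le_trans _ _ ((1 + 1 / (90 * T%:R)) ^+ T)).
  by apply: ler_weXn2l => //; rewrite lerDl.
apply: (@le_trans _ _ (expR (1 / (90 * T%:R)) ^+ T)).
  by apply: lerXn2r; rewrite ?nnegrE ?expR_ge0 ?expR_ge1Dx ?addr_ge0.
rewrite -expRM_natr (_ : 1 / (90 * T%:R) * T%:R = 1 / 90); last first.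
  by field; rewrite gt_eqF.
have lt1 : 1 / 90 < 1 :> R by lra.
have := expR_le_inv _ lt1; rewrite (_ : 1 / 90 / (1 - 1 / 90) = 1 / 89); last by field.
lra.
Qed.

(** Under [sig], the two error probabilities [e1] and [e2] add up to the probability of being in
    [x_0]. The change of measure then trades [e2] for [e3], the same quantity under [flip j sig],
    with a loss below [12 / 100] when [e3 < 1]. *)
Lemma wrong_sign_flip_ge sig j u : (u < T)%N ->
  37 / 100 <=
  iter u (step (trans T gamma sig) pi) (wrong_sign sig j) [::] false +
  iter u (step (trans T gamma (flip j sig)) pi) (wrong_sign (flip j sig) j) [::] false.
Proof.
move=> uT; have T0 := horizon_gt0.
have q0 : 0 <= 1 / (90 * T%:R) :> R by rewrite divr_ge0 // mulr_ge0 // ltW.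
have st (s : Act d) := stochastic_trans s.
have C0 : 0 < 1 + 1 / (90 * T%:R) :> R by lra.
(* The value [1 / 10] nearly balances the error terms [(C ^+ u - 1) / (2 * lam)] and [lam / 2], as
   [C ^+ u - 1] is at most [1 / 89]. *)
have lam0 : 0 < 1 / 10 :> R by lra.
have g01 h s : 0 <= wrong_sign (flip j sig) j h s <= 1.
  rewrite wrong_sign_ge0 /=; have := wrong_sign_flip sig j h s.
  by have := wrong_sign_ge0 sig j h s; case: s => /=; lra.
pose K s := iter u (step (trans T gamma s) pi).
pose e1 := K sig (wrong_sign sig j) [::] false.
pose e2 := K sig (wrong_sign (flip j sig) j) [::] false.
pose e3 := K (flip j sig) (wrong_sign (flip j sig) j) [::] false.
change (37 / 100 <= e1 + e3).
have H : 2 * (1 / 10) * e2 <=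
    (1 + 1 / (90 * T%:R)) ^+ u * (1 + 2 * (1 / 10) * e3 + (1 / 10) ^+ 2) - 1.
  exact: (change_of_measure _ _ pi _ _ u _ [::] false (st (flip j sig)) (st sig) ppi
    C0 lam0 (trans_gt0 (flip j sig)) (chi2_trans sig j) g01).
have V : 49 / 100 <= 1 * e1 + 1 * e2.
  rewrite -iter_stepD; apply: le_trans (visits_ge sig u) _.
  rewrite le_eqVlt; apply/orP; left; apply/eqP.
  by apply: eq_iter_step => h s; rewrite !mul1r wrong_sign_flip.
have e3_0 : 0 <= e3 by apply: iter_step_ge0 => // h s; exact: wrong_sign_ge0.
have := likelihood_bound u (ltnW uT); move: H; set C := _ ^+ u => H HC.
have : C * (1 + 2 * (1 / 10) * e3 + (1 / 10) ^+ 2) <=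
  90 / 89 * (1 + 2 * (1 / 10) * e3 + (1 / 10) ^+ 2).
  by apply: ler_wpM2r => //; lra.
case: (leP 1 e3) => e31; last lra.
have : 0 <= e1 by apply: iter_step_ge0 => // h s; exact: wrong_sign_ge0.
lra.
Qed.

(** The involution [flip j] pairs the parameters, and each pair carries at least [37 / 100]. *)
Lemma mean_wrong_sign_ge j u : (u < T)%N ->
  #|{: Act d}|%:R * (37 / 200) <=
  \sum_(sig : Act d) iter u (step (trans T gamma sig) pi) (wrong_sign sig j) [::] false.
Proof.
move=> uT; set S := \sum_sig _.
have S2 : S = \sum_(sig : Act d)
    iter u (step (trans T gamma (flip j sig)) pi) (wrong_sign (flip j sig) j) [::] false.
  by rewrite /S (reindex_inj (inv_inj (flipK j))).
have : \sum_(sig : Act d) 37 / 100 <= S + S.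
  by rewrite {2}S2 -big_split /=; apply: ler_sum => sig _; exact: wrong_sign_flip_ge.
rewrite sumr_const -[_ *+ _]mulr_natl; lra.
Qed.

(** The bound for one sign is summed over the [n] signs, which cancels the [n] in [D / n], and over
    the [T] time steps. *)
Lemma sum_ExpRegret_ge :
  #|{: Act d}|%:R * ((37 / 200 * (gamma * W * D * T%:R) - gamma / dl) / dl) <=
  \sum_(sig : Act d) ExpRegret T gamma sig pi.
Proof.
have d0 := delta_gt0; have D0 := Delta_gt0; have W0 := W_gt0; have n1 := dim_ge1.
rewrite -/dl -/D in d0 D0.
have n0 : 0 < n by rewrite (lt_le_trans _ n1).
have c0 : 0 <= gamma * W * (D / n).
  exact: mulr_ge0 (mulr_ge0 gamma_ge0 (ltW W0)) (divr_ge0 (ltW D0) (ltW n0)).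
pose e (sig : Act d) j u := iter u (step (trans T gamma sig) pi) (wrong_sign sig j) [::] false.
apply: (@le_trans _ _ (\sum_(sig : Act d)
   (\sum_(u < T) gamma * W * (D / n) * (\sum_j e sig j u) - gamma / dl) / dl)); last first.
  apply: ler_sum => sig _.
  have st := stochastic_trans sig.
  have := le_ExpRegret T gamma sig Vopt gamma_ge0 g1 st (gap_ge0 sig) Vopt_ge0
    pi sig ppi (gap_opt sig) (gap_le1 sig).
  apply: le_trans; rewrite -/(delta gamma) -/dl ler_wpM2r ?invr_ge0 ?(ltW d0) //.
  rewrite lerD2r; apply: ler_sum => u _; rewrite /e.
  apply: le_trans (ler_iter_step _ _ st ppi u _ _ (mean_gap_ge sig) [::] false).
  rewrite -iter_step_sum; set F := fun h s => \sum_j _.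
  have := iter_stepD (trans T gamma sig) pi u (gamma * W * (D / n)) 0
     (fun h s => \sum_j wrong_sign sig j h s) (fun h s => 0) [::] false.
  rewrite iter_step0 [X in _ + X]mulr0 addr0 => <-.
  by rewrite le_eqVlt; apply/orP; left; apply/eqP; apply: eq_iter_step => h s; rewrite mul0r addr0.
rewrite -mulr_suml mulrA ler_wpM2r ?invr_ge0 ?(ltW d0) //.
have EN (c : R) : \sum_(sig : Act d) c = #|{: Act d}|%:R * c.
  by rewrite sumr_const mulr_natl.
rewrite sumrB EN mulrBr lerD2r exchange_big /=.
apply: (@le_trans _ _ (\sum_(u < T) gamma * W * (D / n) * (n * (#|{: Act d}|%:R * (37 / 200))))).
  rewrite sumr_const card_ord -[_ *+ _]mulr_natl.
  rewrite le_eqVlt; apply/orP; left; apply/eqP; field; rewrite gt_eqF //.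
apply: ler_sum => u _; rewrite -mulr_sumr; apply: ler_wpM2l => //.
rewrite exchange_big /=.
have -> : n * (#|{: Act d}|%:R * (37 / 200)) = \sum_(j < d.-1) #|{: Act d}|%:R * (37 / 200).
  by rewrite sumr_const card_ord -[RHS]mulr_natl.
by apply: ler_sum => j _; exact: mean_wrong_sign_ge.
Qed.

End Policy.

(** * Comparison of constants and choice of the parameter *)

Lemma rate_le :
  gamma / (3375 * powR (1 - gamma) (3 / 2)) * d%:R * Num.sqrt T%:R
      - gamma / (1 - gamma) ^+ 2 <=
  (37 / 200 * (gamma * W * D * T%:R) - gamma / dl) / dl.
Proof.
have d0 := delta_gt0; have D0 := Delta_gt0; have W0 := W_gt0; have n1 := dim_ge1.
have T0 := horizon_gt0; have H := Delta_ge; have W1 := W_ge; have gp := gamma_ge0.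
rewrite -/dl -/D -/n in d0 D0 n1 H.
rewrite -/(delta gamma) -/dl.
have r0 : 0 < Num.sqrt dl by rewrite sqrtr_gt0.
have q0 : 0 < Num.sqrt T%:R :> R by rewrite sqrtr_gt0.
have rE : Num.sqrt dl ^+ 2 = dl by rewrite sqr_sqrtr // ltW.
have qE : Num.sqrt T%:R ^+ 2 = T%:R :> R by rewrite sqr_sqrtr // ltW.
have -> : powR dl (3 / 2) = dl * Num.sqrt dl.
  rewrite (_ : 3 / 2 = 1 + 2^-1); last by field.
  by rewrite powRD ?powRr1 ?powR12_sqrt ?(ltW d0) // (gt_eqF d0) implybT.
have dn : d%:R <= 2 * n.
  have -> : d%:R = n + 1 by rewrite /n natr1 prednK // (ltn_trans _ d2).
  lra.
set r := Num.sqrt dl in H r0 rE *; set q := Num.sqrt T%:R in H q0 qE *.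
(* The steps [d <= 2 * n], [Delta_ge] and [W_ge] cost the factors 2, 30 and 4, hence 240 in all,
   while [3375 * (37 / 200)] exceeds 624. *)
have main : d%:R * q * r <= 3375 * (37 / 200) * W * D * T%:R * dl.
  have h1 : d%:R * (q * r) <= 2 * n * (q * r) by rewrite ler_wpM2r // mulr_ge0 // ltW.
  have h2 : n * r * q <= 30 * D * q * q by rewrite ler_wpM2r // ltW.
  have h3 : D * T%:R * 1 <= D * T%:R * (4 * dl * W).
    by rewrite ler_wpM2l // mulr_ge0 // ltW.
  have h4 : 0 <= D * T%:R by rewrite mulr_ge0 // ltW.
  have h5 : 30 * D * q * q = 30 * (D * T%:R) by rewrite -qE; ring.
  lra.
have -> : (37 / 200 * (gamma * W * D * T%:R) - gamma / dl) / dl =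
   37 / 200 * (gamma * W * D * T%:R) / dl - gamma / dl ^+ 2.
  by field; rewrite gt_eqF.
rewrite lerD2r ler_pdivlMr //.
have -> : gamma / (3375 * (dl * r)) * d%:R * q * dl = gamma / 3375 / dl * (d%:R * q * r).
  by rewrite -rE; field; rewrite gt_eqF.
have -> : 37 / 200 * (gamma * W * D * T%:R) =
   gamma / 3375 / dl * (3375 * (37 / 200) * W * D * T%:R * dl).
  by field; rewrite gt_eqF.
by apply: ler_wpM2l main; rewrite !divr_ge0 // ltW.
Qed.

End HardInstance.

Lemma exists_ge_mean {R : realType} {I : finType} (i0 : I) (F : I -> R) (B : R) :
  #|I|%:R * B <= \sum_i F i -> exists i, B <= F i.
Proof.
move=> H; apply: contrapT => N.
suff : \sum_i F i < \sum_(i : I) B by rewrite sumr_const -[B *+ _]mulr_natl ltNge H.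
apply: ltr_sum; last first.
  by move=> i _; rewrite ltNge; apply/negP => h; apply: N; exists i.
by apply/hasP; exists i0; rewrite ?mem_index_enum.
Qed.

Theorem theorem10 (R : realType) (d T : nat) (gamma : R) :
  (2 <= d)%N -> 100 / 101 <= gamma -> gamma < 1 ->
  45 * (d.-1)%:R ^+ 2 / (1 - gamma) <= T%:R ->
  forall pi : policy R d, is_policy pi ->
  exists sig : Act d,
    @L_theta R d T gamma sig <= 100 / 99 /\
    @L_phi R d T gamma <= 1 + ln (gamma / (1 - gamma)) /\
    gamma / (3375 * powR (1 - gamma) (3 / 2)) * d%:R * Num.sqrt T%:R
      - gamma / (1 - gamma) ^+ 2
    <= @ExpRegret R d T gamma sig pi.
Proof.
move=> d2 g100 g1 T45 pi ppi.
have [sig sigP] := exists_ge_mean [ffun=> true] _ _ (sum_ExpRegret_ge d2 g100 g1 T45 pi ppi).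
exists sig; split; first exact: L_theta_le.
split; first exact: L_phi_le.
exact: le_trans (rate_le d2 g100 g1 T45) sigP.
Qed.
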